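(* Let $\mathbb{X}$ be a reflexive Banach space and let $\mathcal{D}$ be a universal dictionary of $\mathbb{X}$. Assume that $\mathcal{E}:\mathbb{X}\to\mathbb{R}$ is a Fréchet differentiable functional satisfying conditions (A) and (B), and let $u^*\in\mathbb{X}$ be a solution of $\min_{x\in\mathbb{X}}\mathcal{E}(x)$. Then each greedy sequence $\{u_m\}_{m\ge 1}$ of $u^*$ by an $\mathcal{E}$-dictionary optimization over $\mathcal{D}$ converges in $\mathbb{X}$ to $u^*$, that is, $\lim_{m\to\infty}\|u^*-u_m\|=0$.
   Context: Banach spaces are real; $\|\cdot\|$ is the norm of $\mathbb{X}$, $\mathbb{X}^*$ its dual with dual norm $\|\cdot\|_*$, and $\langle\cdot,\cdot\rangle:\mathbb{X}^*\times\mathbb{X}\to\mathbb{R}$ the duality pairing. Conditions on a Fréchet differentiable functional $\mathcal{E}:\mathbb{X}\to\mathbb{R}$: (A) the Fréchet derivative $\mathcal{E}':\mathbb{X}\to\mathbb{X}^*$ is locally Lipschitz continuous; (B) there are real numbers $\alpha>0$ and $1<s\le 2$ such that $\langle\mathcal{E}'(x)-\mathcal{E}'(y),x-y\rangle\ge\alpha\|x-y\|^s$ for all $x,y\in\mathbb{X}$. For a non-empty set $A\subset\mathbb{X}$, $\langle A\rangle=\{\lambda a:\lambda\in\mathbb{R},\ a\in A\}$. A subset $\mathcal{D}\subset\mathbb{X}$ is a radial dictionary of $\mathbb{X}$ if $\mathcal{D}=\langle\mathcal{K}\rangle$ for some non-empty (norm-)closed and bounded set $\mathcal{K}\subset\mathbb{X}$.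 It is a universal dictionary of $\mathbb{X}$ if moreover the linear span of $\mathcal{D}$ is dense in $\mathbb{X}$. For $u\in\mathbb{X}$, the $\mathcal{E}$-dictionary optimization over $\mathcal{D}$ is the set $\boldsymbol{\nabla}_u(\mathcal{E};\mathcal{D})=\arg\min_{v\in\mathcal{D}}\mathcal{E}(u+v)\subset\mathcal{D}$, the set of all minimizers $v\in\mathcal{D}$. A greedy sequence of $u^*$ by an $\mathcal{E}$-dictionary optimization over $\mathcal{D}$ is any sequence constructed by $u_0=0$ and, for $m\ge 1$, $u_m\in u_{m-1}+\boldsymbol{\nabla}_{u_{m-1}}(\mathcal{E};\mathcal{D})$.
   Formalization: In (A), ''locally Lipschitz continuous'' is taken as Lipschitz on every bounded set; with the weaker meaning (Lipschitz near each point) the claim fails in infinite-dimensional spaces. *)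

(* Defs.v *)
From HB Require Import structures.
From mathcomp Require Import all_boot all_order all_algebra.
From mathcomp Require Import all_classical all_reals all_analysis.

Set Implicit Arguments.
Unset Strict Implicit.
Unset Printing Implicit Defensive.

Import Order.TTheory GRing.Theory Num.Theory.
Import numFieldNormedType.Exports.

Local Open Scope classical_set_scope.
Local Open Scope ring_scope.

(* The library has no normed space of continuous linear forms: [dual X] is
   X^*, with its operator norm, as a [normedModType]; the bidual is then
   [dual (dual X)]. *)
Section Dual.
Context {R : realType} {X : normedModType R}.
Implicit Types f g : X -> R^o.

Definition continuous_form : {pred X -> R^o} :=
  fun f => `[< linear f /\ continuous f >].

Record dual := Dual {
  dual_fun :> X -> R^o;
  dual_funP : dual_fun \in continuous_form }.

HB.instance Definition _ := [isSub for dual_fun].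
HB.instance Definition _ := [Choice of dual by <:].

Lemma continuous_form_submod_closed : submod_closed continuous_form.
Proof.
split.
  apply/asboolP; split; last by move=> x; exact: cvg_cst.
  by move=> a u v /=; rewrite /GRing.zero/= scaler0 addr0.
move=> a f g /asboolP[lf cf] /asboolP[lg cg]; apply/asboolP; split.
  move=> b u v; rewrite !fctE lf lg.
  by rewrite !scalerDr !scalerA (mulrC a b) addrACA.
by move=> x; apply: cvgD; [apply: cvgZl_tmp; exact: cf | exact: cg].
Qed.

HB.instance Definition _ :=
  GRing.isSubmodClosed.Build R (X -> R^o) continuous_form
    continuous_form_submod_closed.
HB.instance Definition _ := [SubChoice_isSubLmodule of dual by <:].

Lemma dual_linear (f : dual) : linear f.
Proof. by have /asboolP[] := dual_funP f. Qed.

HB.instance Definition _ (f : dual) :=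
  GRing.isLinear.Build R X R^o _ (dual_fun f) (dual_linear f).

Lemma dual_continuous (f : dual) : continuous f.
Proof. by have /asboolP[] := dual_funP f. Qed.

Lemma dual_eqP (f g : dual) : f =1 g -> f = g.
Proof. by move=> fg; apply/val_inj/funext. Qed.

Definition dual_norm (f : dual) : R :=
  sup [set `|f x| | x in [set x : X | `|x| <= 1]].

Let dual_norm_set (f : dual) := [set `|f x| | x in [set x : X | `|x| <= 1]].

Lemma dual_norm_has_sup (f : dual) : has_sup (dual_norm_set f).
Proof.
split; first by exists `|f 0|; exists 0 => //=; rewrite normr0.
have : bounded_near f (nbhs 0).
  exact/linear_bounded_continuous/dual_continuous.
move=> /bounded_funP /(_ 1)[M fM]; exists M => _ [x /= x1 <-]; exact: fM.
Qed.

Lemma dual_norm_ub (f : dual) x : `|x| <= 1 -> `|f x| <= dual_norm f.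
Proof.
by move=> x1; apply: (sup_upper_bound (dual_norm_has_sup f)); exists x.
Qed.

Lemma dual_norm_le (f : dual) M :
  (forall x, `|x| <= 1 -> `|f x| <= M) -> dual_norm f <= M.
Proof.
move=> fM; apply: ge_sup; first exact: (dual_norm_has_sup f).1.
by move=> _ [x /= x1 <-]; exact: fM.
Qed.

Lemma dual_norm_ge0 (f : dual) : 0 <= dual_norm f.
Proof.
by apply: (@le_trans _ _ `|f 0|) => //; apply: dual_norm_ub; rewrite normr0.
Qed.

Lemma le_dual_norm (f : dual) x : `|f x| <= dual_norm f * `|x|.
Proof.
have [->|x0] := eqVneq x 0; first by rewrite linear0 !normr0 mulr0.
have nx0 : 0 < `|x| by rewrite normr_gt0.
rewrite -ler_pdivrMr// mulrC -[X in X * _]gtr0_norm ?invr_gt0//.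
rewrite -normrM; have -> : `|x|^-1 * f x = f (`|x|^-1 *: x).
  by rewrite linearZ.
by apply: dual_norm_ub; rewrite normrZ gtr0_norm ?invr_gt0// mulVf ?gt_eqF.
Qed.

Lemma ler_dual_normD (f g : dual) :
  dual_norm (f + g) <= dual_norm f + dual_norm g.
Proof.
apply: dual_norm_le => x x1; apply: (le_trans (ler_normD _ _)).
by apply: lerD; exact: dual_norm_ub.
Qed.

Lemma dual_normZ (a : R) (f : dual) : dual_norm (a *: f) = `|a| * dual_norm f.
Proof.
have leZ (b : R) (g : dual) : dual_norm (b *: g) <= `|b| * dual_norm g.
  apply: dual_norm_le => x x1.
  rewrite (_ : (b *: g) x = b * g x)// normrM.
  by apply: ler_wpM2l => //; exact: dual_norm_ub.
apply/eqP; rewrite eq_le leZ/=.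
have [->|a0] := eqVneq a 0; first by rewrite normr0 mul0r dual_norm_ge0.
rewrite -{1}(scalerK a0 f) -ler_pdivlMl ?normr_gt0// -normfV; exact: leZ.
Qed.

Lemma dual_norm0_eq0 (f : dual) : dual_norm f = 0 -> f = 0.
Proof.
move=> f0; apply: dual_eqP => x; apply/normr0_eq0/eqP.
by rewrite eq_le normr_ge0 andbT; have := le_dual_norm f x; rewrite f0 mul0r.
Qed.

HB.instance Definition _ := Lmodule_isNormed.Build R dual
  ler_dual_normD dual_normZ dual_norm0_eq0.

Lemma dual_normE (f : dual) : `|f| = dual_norm f.
Proof. by []. Qed.

End Dual.
Arguments dual {R} X.

Section Reflexive.
Context {R : realType} (X : normedModType R).

Lemma evaluation_continuous_form (x : X) :
  (fun f : dual X => f x : R^o) \in @continuous_form R (dual X).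
Proof.
apply/asboolP; have lev : linear (fun f : dual X => f x : R^o) by [].
split=> //.
pose ev : {linear dual X -> R^o} :=
  HB.pack (fun f : dual X => f x : R^o) (GRing.isLinear.Build _ _ _ _ _ lev).
apply/(linear_bounded_continuous ev)/bounded_funP => r.
exists (r * `|x|) => f fr; apply: (le_trans (le_dual_norm f x)).
exact: ler_wpM2r.
Qed.

Definition bidual_embedding (x : X) : dual (dual X) :=
  Dual (evaluation_continuous_form x).

Definition reflexive_space : Prop := range bidual_embedding = setT.

End Reflexive.

Section Functional.
Context {R : realType} {X : normedModType R}.
Implicit Types (E : X -> R^o) (A K D : set X) (u : nat -> X).

Lemma differential_continuous_form E x :
  differentiable E x -> ('d E x : X -> R^o) \in continuous_form.
Proof.
by move=> dE; apply/asboolP; split; [exact: linearP | exact: diff_continuous].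
Qed.

(* E' : X -> X^*; the value is meaningful where E is differentiable. *)
Definition frechet_derivative E (x : X) : dual X :=
  insubd 0 ('d E x : X -> R^o).

Lemma frechet_derivativeE E x :
  differentiable E x -> frechet_derivative E x = 'd E x :> (X -> R^o).
Proof. by move=> dE; apply: insubdK; exact: differential_continuous_form. Qed.

(* "Locally Lipschitz" is taken in the sense of nonlinear functional analysis:
   Lipschitz on every bounded set.  In finite dimension this is the same as
   being Lipschitz near every point, but in infinite dimension the pointwise
   notion is weaker, and too weak for the convergence of greedy sequences. *)
Definition locally_lipschitz {Y : normedModType R} (f : X -> Y) : Prop :=
  forall B : set X, bounded_set B -> [lipschitz f x | x in B].

Definition condition_A E : Prop := locally_lipschitz (frechet_derivative E).

Definition condition_B E : Prop :=
  exists alpha s : R, [/\ 0 < alpha, 1 < s, s <= 2 &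
    forall x y : X,
      alpha * `|x - y| `^ s <=
      (frechet_derivative E x - frechet_derivative E y) (x - y)].

Definition radial_hull A : set X :=
  [set x | exists (l : R) (a : X), A a /\ x = l *: a].

Definition linear_span A : set X :=
  [set x | exists (n : nat) (c : 'I_n -> R) (a : 'I_n -> X),
    (forall i, A (a i)) /\ x = \sum_(i < n) c i *: a i].

Definition radial_dictionary D : Prop :=
  exists K, [/\ K !=set0, closed K, bounded_set K & D = radial_hull K].

Definition universal_dictionary D : Prop :=
  radial_dictionary D /\ dense (linear_span D).

Definition dictionary_optimization E D (x : X) : set X :=
  [set v | D v /\ forall w, D w -> E (x + v) <= E (x + w)].

Definition greedy_sequence E D u : Prop :=
  u 0%N = 0 /\
  forall m, [set u m + v | v in dictionary_optimization E D (u m)] (u m.+1).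

End Functional.

(* Main.v *)
Require Import Defs.
From HB Require Import structures.
From mathcomp Require Import all_boot all_order all_algebra.
From mathcomp Require Import all_classical all_reals all_analysis.
From mathcomp Require Import ring lra.

Set Implicit Arguments.
Unset Strict Implicit.
Unset Printing Implicit Defensive.

Import Order.TTheory GRing.Theory Num.Theory.
Import numFieldNormedType.Exports.

Local Open Scope classical_set_scope.
Local Open Scope ring_scope.

(** The energy gaps e_n = E(u_n) - E(ustar) decrease, and by strong monotonicity
    they dominate |u_n - ustar|^2 up to a constant; so it is enough to find a
    single n with e_n as small as desired.

    All u_n lie in one ball around ustar. There the derivative is Lipschitz,
    say with constant L, and as s <= 2 condition (B) is at least quadratic.
    Let v_n = u_(n+1) - u_n.
    - The step v_n is optimal on its own line, so E'(u_(n+1)) v_n = 0 and each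
      step gains e_n - e_(n+1) >= c |v_n|^2. Hence the series of the |v_n|^2
      converges.
    - The step does at least as well as every multiple of any z in D, while it
      gains no more than L |v_n|^2. Minimizing the quadratic upper bound of E
      along z gives |E'(u_n) z| <= 2 L |v_n| |z| ([greedy_residual_le]).

    By convexity, e_n <= E'(u_n)(u_n - ustar). Write ustar = z + (ustar - z)
    with z in the span of D close to ustar: the part in ustar - z is small
    uniformly in n, the part in z is at most 2 L |v_n| K with K independent of
    n, and the part in u_n, which is the sum of the v_k for k < n, is at most
    2 L |v_n| (|v_0| + ... + |v_(n-1)|). The last two are small together for
    some n by [exists_small_mul_partial_sum]: for square-summable a, the
    numbers a_n (K + a_0 + ... + a_(n-1)) come arbitrarily close to 0, since
    otherwise a_n^2 would dominate a multiple of the harmonic series. *)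

(** * Square-summable sequences and real powers *)

Section Reals.
Context {R : realType}.
Implicit Types (a : R ^nat) (x r s t : R).

Lemma sqr_sum_le a n :
  (\sum_(0 <= k < n) a k) ^+ 2 <= n%:R * \sum_(0 <= k < n) a k ^+ 2.
Proof.
elim: n => [|n ih]; first by rewrite !big_geq// expr0n mul0r.
rewrite !big_nat_recr//= -natr1.
set S := \sum_(_ <= _ < _) a _ in ih *.
set Q := \sum_(_ <= _ < _) a _ ^+ 2 in ih *.
have : 2 * a n * S <= Q + n%:R * a n ^+ 2.
  have -> : n%:R * a n ^+ 2 = \sum_(0 <= k < n) a n ^+ 2.
    by rewrite sumr_const_nat subn0 mulr_natl.
  rewrite /S /Q mulr_sumr -big_split/=; apply: ler_sum => k _.
  by have := sqr_ge0 (a k - a n); nra.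
by nra.
Qed.

(** If a_n (K + S_n) >= e for all n, where S_n is the partial sum, then, as
    S_n^2 <= n b by Cauchy-Schwarz, a_n^2 >= e^2 / (C (n + 1)) with C
    independent of n, and the squares would not be summable. *)
Lemma exists_small_mul_partial_sum a (b K e : R) :
    (forall n, 0 <= a n) -> (forall n, \sum_(0 <= k < n) a k ^+ 2 <= b) ->
    0 <= K -> 0 < e ->
  exists n, a n * (K + \sum_(0 <= k < n) a k) < e.
Proof.
move=> a0 ab K0 e0; apply: contrapT => /forallNP ae.
have b0 : 0 <= b by have := ab 0; rewrite big_geq.
pose C := 2 * K ^+ 2 + 2 * b + 1.
have C0 : 0 < C by have := sqr_ge0 K; rewrite /C; lra.
apply: (@dvg_harmonic R).
apply: (@series_le_cvg R _ (fun n => C / e ^+ 2 * a n ^+ 2)).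
- by move=> n; exact: harmonic_ge0.
- by move=> n; rewrite mulr_ge0 ?sqr_ge0 ?divr_ge0 ?sqr_ge0 ?ltW.
- move=> n /=; rewrite mulrAC ler_pdivlMr ?exprn_gt0//.
  rewrite mulrC ler_pdivrMr ?ltr0n//.
  have /negP := ae n; rewrite -leNgt; set S := \sum_(_ <= _ < _) _ => aS.
  have S0 : 0 <= S by apply: sumr_ge0.
  have S2 : S ^+ 2 <= n%:R * b.
    by apply: (le_trans (sqr_sum_le a n)); rewrite ler_wpM2l.
  have : e ^+ 2 <= (a n * (K + S)) ^+ 2.
    by rewrite ler_sqr ?nnegrE ?(ltW e0)// (le_trans (ltW e0)).
  move=> /le_trans; apply; rewrite exprMn -natr1.
  have -> : C * a n ^+ 2 * (n%:R + 1) = a n ^+ 2 * (C * (n%:R + 1)) by ring.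
  apply: ler_wpM2l; first exact: sqr_ge0.
  (* (K + S)^2 <= 2 K^2 + 2 S^2 *)
  have := sqr_ge0 (K - S).
  have : 0 <= n%:R * K ^+ 2 by rewrite mulr_ge0 ?sqr_ge0.
  have : 0 <= n%:R :> R by [].
  move: S2 b0.
  rewrite /C; have := sqr_ge0 K; nra.
- apply: nondecreasing_is_cvgn.
    apply/nondecreasing_seqP => n; rewrite /series/= big_nat_recr//= lerDl.
    by rewrite mulr_ge0 ?sqr_ge0 ?divr_ge0 ?sqr_ge0 ?ltW.
  exists (C / e ^+ 2 * b) => _ [n _ <-]; rewrite /series/= -mulr_sumr.
  by rewrite ler_wpM2l// divr_ge0 ?sqr_ge0 ?ltW.
Qed.

Lemma sqr_le_powR x r s : 0 <= x <= r -> 0 < s <= 2 ->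
  x ^+ 2 <= r `^ (2 - s) * x `^ s.
Proof.
move=> /andP[x0 xr] /andP[s0 s2].
have [->|xn0] := eqVneq x 0; first by rewrite powR0 ?gt_eqF// mulr0 expr0n.
rewrite -powR_mulrn// -[X in x `^ X](subrK s) powRD ?xn0 ?implybT//.
by rewrite ler_wpM2r ?powR_ge0// ge0_ler_powR ?nnegrE ?subr_ge0// (le_trans x0).
Qed.

Lemma le_1D_powR x s : 0 <= x -> 1 <= s -> x <= 1 + x `^ s.
Proof.
move=> x0 s1; have := powR_ge0 x s; have [x1|x1] := leP x 1; first by lra.
by have := ler_powR (ltW x1) s1; rewrite powRr1//; lra.
Qed.

End Reals.

(** * Dictionaries, spans and Lipschitz maps *)

Lemma radial_dictionaryZ (R : realType) (X : normedModType R) (D : set X) :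
  radial_dictionary D -> forall l w, D w -> D (l *: w).
Proof.
move=> [K [_ _ _ ->]] l w [m [a [Ka ->]]].
by exists (l * m), a; rewrite scalerA.
Qed.

Lemma locally_lipschitz_ball (R : realType) (X Y : normedModType R) (f : X -> Y)
    (x0 : X) (r : R) : locally_lipschitz f ->
  exists2 L, 0 < L & forall x y, `|x0 - x| <= r -> `|x0 - y| <= r ->
    `|f x - f y| <= L * `|x - y|.
Proof.
move=> lipf.
have Bbnd : bounded_set [set x : X | `|x0 - x| <= r].
  exists (`|x0| + r); split; first exact: num_real.
  move=> M rM x /= xr; apply: le_trans (ltW rM).
  have -> : x = x0 - (x0 - x) by rewrite opprB addrC subrK.
  by apply: (le_trans (ler_normB _ _)); rewrite lerD2l.
have [M [_ MP]] := lipf _ Bbnd.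
exists (`|M| + 1); first by rewrite ltr_wpDl.
have ltM : M < `|M| + 1 by rewrite (le_lt_trans (ler_norm _))// ltrDl.
move=> x y xr yr; exact: (MP _ ltM (x, y)).
Qed.

(** Only one constant K, depending on z alone, is extracted from a
    representation of z; it then serves all the derivatives E'(u_n) at once,
    with a bound b that varies with n. *)
Lemma linear_span_form_le (R : realType) (X : normedModType R) (D : set X)
    (z : X) : linear_span D z ->
  exists2 K, 0 <= K & forall (f : dual X) b, 0 <= b ->
    (forall w, D w -> `|f w| <= b * `|w|) -> `|f z| <= b * K.
Proof.
move=> [n [c [a [Da ->]]]].
exists (\sum_(i < n) `|c i| * `|a i|).
  by apply: sumr_ge0 => i _; rewrite mulr_ge0.
move=> f b b0 fD; rewrite linear_sum mulr_sumr.
apply: (le_trans (ler_norm_sum _ _ _)); apply: ler_sum => i _.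
by rewrite linearZ normrM mulrCA ler_wpM2l// fD.
Qed.

(** * First-order expansion of the functional *)

Section Functional.
Context {R : realType} {X : normedModType R}.
Context (E : X -> R^o).
Context (diffE : forall x, differentiable E x).
Implicit Types (x y d : X) (D : set X).

Local Notation dE := (frechet_derivative E).

Lemma is_derive_line x d (t : R) :
  is_derive t 1 (fun r : R => E (x + r *: d) : R) (dE (x + t *: d) d).
Proof.
have quotient :
    (fun h : R => h^-1 *:
       (((fun r : R => E (x + r *: d)) \o shift t) (h *: 1) -
        E (x + t *: d))) =
    (fun h : R => h^-1 *:
       ((E \o shift (x + t *: d)) (h *: d) - E (x + t *: d))).
  apply/funext => h /=; congr (_ *: (E _ - _)).
  by rewrite [h *: 1]mulr1 scalerDl addrCA.
have dv := @diff_derivable _ _ _ E (x + t *: d) d (diffE _).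
split; first by rewrite /derivable quotient.
by rewrite frechet_derivativeE// -deriveE// /derive quotient.
Qed.

Lemma segment_mean_value x d (a b : R) : a < b ->
  exists2 c : R, a < c < b &
    E (x + b *: d) - E (x + a *: d) = dE (x + c *: d) d * (b - a).
Proof.
move=> ab; have dline t := is_derive_line x d t.
have [|c cab eq] := @MVT R (fun r => E (x + r *: d))
  (fun r => dE (x + r *: d) d) a b ab.
- by apply: derivable_within_continuous => t _; have [] := dline t.
- by exists c => //; move: cab; rewrite in_itv.
Qed.

Lemma line_min_frechet_derivative_eq0 x d :
  (forall t : R, E x <= E (x + t *: d)) -> dE x d = 0.
Proof.
move=> xmin; have dline t := is_derive_line x d t.
have : is_derive (0 : R) 1 (fun r : R => E (x + r *: d) : R) 0.
  apply: (@derive1_at_min R _ (-1) 1); rewrite ?in_itv/= ?ltrN10 ?ltr01//.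
  by move=> t _; rewrite scale0r addr0.
by move=> [_ d0]; have [_] := dline 0; rewrite d0 scale0r addr0.
Qed.

Lemma first_order_gap_le (L r : R) (x0 x d : X) :
    (forall y y', `|x0 - y| <= r -> `|x0 - y'| <= r ->
      `|dE y - dE y'| <= L * `|y - y'|) ->
    0 <= L -> `|x0 - x| + `|d| <= r ->
  E (x + d) - E x - dE x d <= L * `|d| ^+ 2.
Proof.
move=> lip L0 xr; have [t /andP[t0 t1]] := segment_mean_value x d ltr01.
rewrite scale1r scale0r addr0 subr0 mulr1 => ->.
have -> : dE (x + t *: d) d - dE x d = (dE (x + t *: d) - dE x) d by [].
apply: (le_trans (ler_norm _)); apply: (le_trans (le_dual_norm _ _)).
rewrite -dual_normE expr2 mulrA ler_wpM2r//.
have td : `|t *: d| <= `|d| by rewrite normrZ gtr0_norm// ler_piMl// ltW.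
apply: (le_trans (lip _ _ _ _)).
- rewrite opprD addrA; apply: (le_trans (ler_normB _ _)).
  by rewrite (le_trans _ xr)// lerD2l.
- by rewrite (le_trans _ xr)// lerDl.
- by rewrite addrAC subrr add0r ler_wpM2l.
Qed.

(** The mean value theorem on the whole segment would locate a point that may
    be arbitrarily close to x, where monotonicity gives nothing. It is applied
    on the two halves instead: the first contributes a nonnegative amount, and
    on the second the intermediate point is at distance at least |d| / 2 from
    x. *)
Lemma first_order_gap_ge (alpha s : R) (x d : X) :
    (forall x y, alpha * `|x - y| `^ s <= (dE x - dE y) (x - y)) ->
    0 < alpha -> 0 <= s ->
  alpha / 2 * (`|d| / 2) `^ s <= E (x + d) - E x - dE x d.
Proof.
move=> mono al0 s0.
have slope t : 0 < t ->
    alpha * (t * `|d|) `^ s <= t * (dE (x + t *: d) d - dE x d).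
  move=> t0; have := mono (x + t *: d) x.
  rewrite addrAC subrr add0r normrZ gtr0_norm//.
  by move=> /le_trans; apply; rewrite linearZ.
have half0 : (0 : R) < 2^-1 by rewrite invr_gt0.
have [t /andP[t0 _]] := segment_mean_value x d half0.
have half1 : (2^-1 : R) < 1 by rewrite invf_lt1// ltr1n.
have [t' /andP[t'0 t'1]] := segment_mean_value x d half1.
rewrite scale1r scale0r addr0 => eq1 eq0.
have g0 : 0 <= dE (x + t *: d) d - dE x d.
  by rewrite -(pmulr_rge0 _ t0) (le_trans _ (slope _ t0))//
    mulr_ge0 ?powR_ge0// ltW.
have t'gt0 : 0 < t' by rewrite (lt_trans half0).
have g1 : alpha * (`|d| / 2) `^ s <= t' * (dE (x + t' *: d) d - dE x d).
  apply: le_trans (slope _ t'gt0); rewrite ler_wpM2l ?(ltW al0)//.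
  rewrite ge0_ler_powR ?nnegrE ?mulr_ge0 ?invr_ge0 ?(ltW t'gt0)//.
  by rewrite mulrC ler_wpM2r// ltW.
have {}g1 : alpha * (`|d| / 2) `^ s <= dE (x + t' *: d) d - dE x d.
  apply: (le_trans g1); rewrite ler_piMl ?(ltW t'1)//.
  by rewrite -(pmulr_rge0 _ t'gt0) (le_trans _ g1)// mulr_ge0 ?powR_ge0// ltW.
move: (_ `^ s) g0 g1 eq0 eq1 => P; lra.
Qed.

(** On a ball the exponent s may be replaced by 2, because s <= 2; the constant
    degrades by the factor rho `^ (2 - s), and the factor 8 is 2 * 2 ^ 2, from
    alpha / 2 and from the half distance. *)
Lemma first_order_gap_ge_sqr (alpha s rho : R) (x d : X) :
    (forall x y, alpha * `|x - y| `^ s <= (dE x - dE y) (x - y)) ->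
    0 < alpha -> 0 < s <= 2 -> 0 < rho -> `|d| <= 2 * rho ->
  alpha / (8 * rho `^ (2 - s)) * `|d| ^+ 2 <= E (x + d) - E x - dE x d.
Proof.
move=> mono al0 s02 rho0 drho.
have s0 : 0 <= s by lra.
apply: le_trans (first_order_gap_ge x d mono al0 s0).
have d2 : 0 <= `|d| / 2 <= rho.
  by rewrite divr_ge0//=; lra.
have := sqr_le_powR d2 s02.
have : 0 < rho `^ (2 - s) by rewrite powR_gt0.
move: (rho `^ _) (_ `^ s) => P Q P0 h.
rewrite mulrAC ler_pdivrMr; last by rewrite mulr_gt0.
have -> : alpha * `|d| ^+ 2 = 4 * alpha * (`|d| / 2) ^+ 2 by field.
have -> : alpha / 2 * Q * (8 * P) = 4 * alpha * (P * Q) by field.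
by rewrite ler_wpM2l// mulr_ge0// ltW.
Qed.

(** * One greedy step *)

(** Since v is also the best multiple of itself, the new residual annihilates
    it. *)
Lemma optimization_frechet_derivative_eq0 D x v :
    (forall l w, D w -> D (l *: w)) -> dictionary_optimization E D x v ->
  dE (x + v) v = 0.
Proof.
move=> scaleD [Dv vmin]; apply: line_min_frechet_derivative_eq0 => t.
have -> : x + v + t *: v = x + (1 + t) *: v by rewrite scalerDl scale1r addrA.
exact/vmin/scaleD.
Qed.

(** The optimal t for the upper bound E(x) + t E'(x) z + L t^2 |z|^2 gives a
    gain (E'(x) z)^2 / (4 L |z|^2), and the gain of v is at most L |v|^2. As
    |E'(x)| <= L rho, the trial point x + t z is within 2 rho of x0; the segment
    from x + v back to x is within 3 rho, which explains the radius. *)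
Lemma greedy_residual_le D (L rho : R) (x0 x v z : X) :
    (forall l w, D w -> D (l *: w)) ->
    (forall y y', `|x0 - y| <= 3 * rho -> `|x0 - y'| <= 3 * rho ->
      `|dE y - dE y'| <= L * `|y - y'|) ->
    0 < L -> dE x0 = 0 -> `|x0 - x| <= rho -> `|x0 - (x + v)| <= rho ->
    dictionary_optimization E D x v -> D z ->
  `|dE x z| <= 2 * L * `|v| * `|z|.
Proof.
move=> scaleD lip L0 dE0 xrho xvrho vopt Dz.
have [_ vmin] := vopt.
have [->|z0] := eqVneq z 0; first by rewrite linear0 !normr0 mulr0.
have nz0 : 0 < `|z| by rewrite normr_gt0.
have rho0 : 0 <= rho by rewrite (le_trans _ xrho).
have vrho : `|v| <= 2 * rho.
  have -> : v = (x0 - x) - (x0 - (x + v)).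
    by rewrite opprB addrC addrA subrK addrAC subrr add0r.
  apply: (le_trans (ler_normB _ _)); lra.
have upper : E x - E (x + v) <= L * `|v| ^+ 2.
  have := @first_order_gap_le L (3 * rho) x0 (x + v) (- v) lip (ltW L0).
  have -> : dE (x + v) (- v) = 0.
    have /= -> := linearN (dE (x + v)) v.
    by rewrite (optimization_frechet_derivative_eq0 scaleD vopt) oppr0.
  by rewrite addrK normrN subr0; apply; lra.
have dExz : `|dE x z| <= L * rho * `|z|.
  apply: (le_trans (le_dual_norm _ _)); rewrite ler_wpM2r// -dual_normE.
  have x0b : `|x0 - x0| <= 3 * rho by rewrite subrr normr0; lra.
  have xb : `|x0 - x| <= 3 * rho by lra.
  have := lip x x0 xb x0b; rewrite dE0 subr0 distrC => /le_trans; apply.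
  by rewrite ler_wpM2l// ltW.
have den0 : 0 < 2 * L * `|z| ^+ 2 by rewrite !mulr_gt0.
pose t := - dE x z / (2 * L * `|z| ^+ 2).
have lower : E (x + t *: z) - E x - t * dE x z <= L * (t * `|z|) ^+ 2.
  have -> : t * dE x z = dE x (t *: z) by rewrite linearZ.
  have -> : (t * `|z|) ^+ 2 = `|t *: z| ^+ 2.
    by rewrite normrZ [LHS]exprMn [RHS]exprMn real_normK ?num_real.
  apply: first_order_gap_le lip (ltW L0) _.
  have -> : `|t *: z| = `|dE x z| / (2 * L * `|z| ^+ 2) * `|z|.
    by rewrite normrZ /t normrM normrN normfV (gtr0_norm den0).
  suff : `|dE x z| / (2 * L * `|z| ^+ 2) * `|z| <= rho by lra.
  rewrite mulrAC ler_pdivrMr//.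
  have -> : rho * (2 * L * `|z| ^+ 2) = 2 * (L * rho * `|z|) * `|z| by ring.
  rewrite ler_wpM2r//; have := normr_ge0 (dE x z : R); lra.
have dec := vmin _ (scaleD t _ Dz).
have : dE x z ^+ 2 / (4 * L * `|z| ^+ 2) <= L * `|v| ^+ 2.
  have -> : dE x z ^+ 2 / (4 * L * `|z| ^+ 2) =
      - (t * dE x z) - L * (t * `|z|) ^+ 2.
    by rewrite /t; field; rewrite !gt_eqF.
  lra.
rewrite ler_pdivrMr; last by rewrite !mulr_gt0.
rewrite -[_ ^+ 2]real_normK ?num_real// => h.
rewrite -ler_sqr ?nnegrE// ?mulr_ge0 ?(ltW L0)//.
apply: (le_trans h); lra.
Qed.

End Functional.

(** * Convergence *)

Theorem theorem4p2 (R : realType) (X : completeNormedModType R)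
    (D : set X) (E : X -> R^o) (ustar : X) (u : nat -> X) :
  reflexive_space X ->
  universal_dictionary D ->
  (forall x : X, differentiable E x) ->
  condition_A E ->
  condition_B E ->
  (forall x : X, E ustar <= E x) ->
  greedy_sequence E D u ->
  `|ustar - u m| @[m --> \oo] --> (0 : R).
Proof.
move=> _ [/radial_dictionaryZ scaleD denseD] diffE lipE.
move=> [alpha [s [al0 s1 s2 mono]]] ustar_min [u0 u_greedy].
pose dE := frechet_derivative E.
have dEstar : dE ustar = 0.
  by apply: dual_eqP => d; exact: line_min_frechet_derivative_eq0.
pose v n := u n.+1 - u n.
have uS n : u n.+1 = u n + v n by rewrite addrC subrK.
have v_opt n : dictionary_optimization E D (u n) (v n).
  by have [w w_opt wE] := u_greedy n; rewrite /v -wE addrC addKr.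
have Dv n : D (v n) by have [] := v_opt n.
have uE n : u n = \sum_(0 <= k < n) v k by rewrite telescope_sumr// u0 subr0.
(* the step 0 belongs to D *)
have e_decr n m : (n <= m)%N -> E (u m) <= E (u n).
  elim: m => [|m ih]; first by rewrite leqn0 => /eqP ->.
  rewrite leq_eqVlt => /predU1P[<-//|/ih]; apply: le_trans.
  have [_ vmin] := v_opt m; rewrite uS.
  by have := vmin _ (scaleD 0 _ (Dv m)); rewrite scale0r addr0.
(* chosen so that E ustar + alpha / 2 * (d / 2) `^ s <= E 0 forces d <= rho *)
pose rho := 2 * (1 + (E 0 - E ustar) / (alpha / 2)).
have rho0 : 0 < rho.
  rewrite mulr_gt0// ltr_wpDr// divr_ge0 ?subr_ge0// divr_ge0//.
  exact: ltW.
have u_bnd n : `|ustar - u n| <= rho.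
  have s0 : 0 <= s by lra.
  have := first_order_gap_ge diffE ustar (u n - ustar) mono al0 s0.
  rewrite -/dE dEstar subr0 subrKC distrC => gap.
  have {}gap : alpha / 2 * (`|ustar - u n| / 2) `^ s <= E 0 - E ustar.
    by apply: (le_trans gap); rewrite lerB// -u0 e_decr.
  have d0 : 0 <= `|ustar - u n| / 2 by rewrite divr_ge0.
  have := le_1D_powR d0 (ltW s1).
  have : (`|ustar - u n| / 2) `^ s <= (E 0 - E ustar) / (alpha / 2).
    by rewrite ler_pdivlMr ?divr_gt0// mulrC.
  rewrite /rho; lra.
have [L L0 lipL] := locally_lipschitz_ball ustar (3 * rho) lipE.
pose c := alpha / (8 * rho `^ (2 - s)).
have c0 : 0 < c by rewrite divr_gt0// mulr_gt0// powR_gt0.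
have s02 : 0 < s <= 2 by lra.
have gap x d : `|d| <= 2 * rho -> c * `|d| ^+ 2 <= E (x + d) - E x - dE x d.
  exact: first_order_gap_ge_sqr.
have dec n : c * `|v n| ^+ 2 <= E (u n) - E (u n.+1).
  have := gap (u n.+1) (- v n).
  have -> : u n.+1 - v n = u n by rewrite uS addrK.
  rewrite normrN.
  have -> : dE (u n.+1) (- v n) = 0.
    have /= -> := linearN (dE (u n.+1)) (v n).
    by rewrite uS (optimization_frechet_derivative_eq0 diffE scaleD)// oppr0.
  rewrite subr0; apply.
  have -> : v n = (ustar - u n) - (ustar - u n.+1).
    by rewrite opprB addrC addrA subrK.
  by apply: (le_trans (ler_normB _ _)); rewrite mulr_natl mulr2n lerD.
have sum_sqr n : \sum_(0 <= k < n) `|v k| ^+ 2 <= (E 0 - E ustar) / c.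
  rewrite ler_pdivlMr// mulrC mulr_sumr.
  apply: (@le_trans _ _ (\sum_(0 <= k < n) (E (u k) - E (u k.+1)))).
    by apply: ler_sum => k _; exact: dec.
  rewrite (@telescope_sumr_eq R _ _ (fun k => - E (u k)))//; last first.
    by move=> k _; rewrite opprK addrC.
  by rewrite u0 opprK addrC lerB.
have residual n w : D w -> `|dE (u n) w| <= 2 * L * `|v n| * `|w|.
  by move=> Dw; apply: (greedy_residual_le diffE scaleD lipL); rewrite -?uS.
have e_small (e : R) : 0 < e -> exists n, E (u n) - E ustar < e.
  move=> e0.
  pose delta := e / (2 * (L * rho)).
  have delta0 : 0 < delta by rewrite divr_gt0// mulr_gt0// mulr_gt0.
  have [|z [zball zspan]] := denseD _ _ (ball_open ustar delta).
    by exists ustar; exact: ballxx.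
  have [K K0 KP] := linear_span_form_le zspan.
  have e'0 : 0 < e / (4 * L) by rewrite divr_gt0// mulr_gt0.
  have [n nP] := exists_small_mul_partial_sum
    (fun n => normr_ge0 (v n)) sum_sqr K0 e'0.
  exists n; set S := \sum_(_ <= _ < _) _ in nP.
  have gz : `|dE (u n) z| <= 2 * L * `|v n| * K.
    by apply: KP; [rewrite !mulr_ge0// ltW | exact: residual].
  have gu : `|dE (u n) (u n)| <= 2 * L * `|v n| * S.
    rewrite [X in dE _ X]uE linear_sum mulr_sumr.
    apply: (le_trans (ler_norm_sum _ _ _)); apply: ler_sum => k _.
    exact: residual.
  have gd : `|dE (u n) (ustar - z)| <= e / 2.
    apply: (le_trans (le_dual_norm _ _)); rewrite -dual_normE.
    have -> : e / 2 = L * rho * delta by rewrite /delta; field; rewrite !gt_eqF.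
    apply: ler_pM => //; last by move: zball; rewrite -ball_normE => /ltW.
    have star_in : `|ustar - ustar| <= 3 * rho by rewrite subrr normr0; lra.
    have un_in : `|ustar - u n| <= 3 * rho by have := u_bnd n; lra.
    have := lipL _ _ un_in star_in.
    rewrite -/dE dEstar subr0 distrC => /le_trans; apply.
    by rewrite ler_wpM2l// ltW.
  (* convexity: the gap at u n in the direction of ustar is nonnegative *)
  have : 0 <= E ustar - E (u n) - dE (u n) (ustar - u n).
    rewrite -[X in E X - _](subrKC (u n)); apply: le_trans (gap _ _ _).
      by rewrite mulr_ge0 ?sqr_ge0// ltW.
    by rewrite (le_trans (u_bnd n))//; lra.
  have -> : dE (u n) (ustar - u n) =
      dE (u n) z + dE (u n) (ustar - z) - dE (u n) (u n).
    by rewrite -raddfD subrKC -raddfB.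
  have {}nP : 2 * L * `|v n| * K + 2 * L * `|v n| * S < e / 2.
    have -> : e / 2 = 2 * L * (e / (4 * L)) by field; rewrite gt_eqF.
    by rewrite -mulrDr -mulrA ltr_pM2l// mulr_gt0.
  move: gz gu gd; rewrite !ler_norml => /andP[gz _] /andP[_ gu] /andP[gd _].
  lra.
apply/cvgrPdist_lt => e e0.
have ce0 : 0 < c * e ^+ 2 by rewrite mulr_gt0// exprn_gt0.
have [n en] := e_small _ ce0.
exists n => // m /= nm; rewrite sub0r normrN normr_id.
have := gap ustar (u m - ustar); rewrite dEstar subr0 subrKC distrC => h.
have {h} : c * `|ustar - u m| ^+ 2 < c * e ^+ 2.
  apply: le_lt_trans en; apply: (le_trans (h _)).
    by rewrite (le_trans (u_bnd m))//; lra.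
  by rewrite lerB// e_decr.
by rewrite ltr_pM2l// ltr_sqr ?nnegrE// ltW.
Qed.
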